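(* Let $\mathbb{H}$ be a connected hypergraph with vertex set $H=\{1,\dots,n\}$, ordered by the usual order. Then any vector $\mu=(\mu_1,\dots,\mu_n)\in\mathbb{R}^n$ with strictly decreasing coordinates ($\mu_1>\mu_2>\cdots>\mu_n$) is an orientation vector for the polytope $$P_{\mathbb{H}}=\sum_{E\in\mathrm{Sat}(\mathbb{H})}\Delta^E\subset\mathbb{R}^n .$$
   Context: A hypergraph $\mathbb{H}$ consists of a finite set $H$ of vertices and a set $\mathbb{H}\subseteq\mathcal{P}(H)\setminus\{\emptyset\}$ of hyperedges with $\bigcup\mathbb{H}=H$; it is always assumed atomic, i.e. $\{x\}\in\mathbb{H}$ for all $x\in H$. For $X\subseteq H$, $\mathbb{H}_X=\{Z\in\mathbb{H}\mid Z\subseteq X\}$. $\mathbb{H}$ is connected if $H\ne\emptyset$ and there is no partition $H=X_1\sqcup X_2$ into non-empty sets with $\mathbb{H}=\mathbb{H}_{X_1}\cup\mathbb{H}_{X_2}$. $\mathrm{Sat}(\mathbb{H})=\{X\mid\emptyset\neq X\subseteq H,\ \mathbb{H}_X\text{ is connected}\}$. For non-empty $I\subseteq\{1,\dots,n\}$, $\Delta^I\subset\mathbb{R}^n$ is the convex hull of the standard basis vectors $e_i$, $i\in I$; the sum is a Minkowski sum ($P_{\mathbb{H}}$ is the Postnikov realization of the hypergraph polytope of $\mathbb{H}$). An orientation vector of a polytope $P\subset\mathbb{R}^n$ is a vector $\mu\in\mathbb{R}^n$ that is not perpendicular to any edge of $P$. *)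

(* Defs.v *)
From HB Require Import structures.
From mathcomp Require Import all_boot all_order all_algebra.
From mathcomp Require Import boolp classical_sets reals convex.

Set Implicit Arguments.
Unset Strict Implicit.
Unset Printing Implicit Defensive.

Import Order.TTheory GRing.Theory Num.Theory.

Local Open Scope ring_scope.

Section Hypergraphs.
Variable T : finType.
Implicit Types (H X : {set T}) (HH : {set {set T}}).

(* A hypergraph is a pair (H, HH) of a vertex set and a set of hyperedges, so
   that the restriction of HH to X is the pair (X, HH ::&: X). *)
Definition is_hypergraph H HH : Prop :=
  [/\ finset.set0 \notin HH, finset.cover HH = H & forall x, x \in H -> [set x]%SET \in HH].

Definition hyper_connected H HH : bool :=
  (H != finset.set0) &&
  ~~ [exists X1 : {set T}, exists X2 : {set T},
       [&& X1 != finset.set0, X2 != finset.set0, X1 :|: X2 == H, [disjoint X1 & X2]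
         & HH == (HH ::&: X1) :|: (HH ::&: X2)]].

Definition Sat H HH : {set {set T}} :=
  [set X : {set T} | [&& X != finset.set0, X \subset H
                       & hyper_connected X (HH ::&: X)]]%SET.

End Hypergraphs.

Local Open Scope classical_set_scope.

Section Polytopes.
Variables (R : realType) (n : nat).
Implicit Types (A P F : set 'rV[R]_n) (x y c mu : 'rV[R]_n).

Definition dot x y : R := \sum_(i < n) x 0 i * y 0 i.

Definition convex_hull A : set 'rV[R]_n :=
  smallest (fun C : set 'rV[R]_n => convex_set C) A.

Definition std_simplex (I : {set 'I_n}) : set 'rV[R]_n :=
  convex_hull [set delta_mx 0 i | i in [set` I]].

Definition minkowski_sum (J : finType) (D : {set J}) (A : J -> set 'rV[R]_n) :
    set 'rV[R]_n :=
  [set x | exists2 f : J -> 'rV[R]_n,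
             forall j, j \in D -> A j (f j) & x = \sum_(j in D) f j].

Definition affine_set A : Prop :=
  forall (t : R) x y, A x -> A y -> A (t *: x + (1 - t) *: y).

Definition affine_hull A : set 'rV[R]_n := smallest affine_set A.

Definition affine_dim A (d : nat) : Prop :=
  exists p (U : {vspace 'rV[R]_n}),
    affine_hull A = [set p + u | u in [set` U]] /\ \dim U = d.

(* Faces are cut out by valid linear inequalities; c = 0 gives P itself and
   the empty face. *)
Definition is_face P F : Prop :=
  exists c (b : R), (forall x, P x -> dot c x <= b) /\
                    F = P `&` [set x | dot c x = b].

Definition is_edge P F : Prop := is_face P F /\ affine_dim F 1.

Definition perpendicular mu F : Prop :=
  forall x y, F x -> F y -> dot mu (x - y) = 0.

Definition orientation_vector P mu : Prop :=
  forall F, is_edge P F -> ~ perpendicular mu F.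

Definition postnikov_polytope (HH : {set {set 'I_n}}) : set 'rV[R]_n :=
  minkowski_sum (Sat [set: 'I_n]%SET HH) std_simplex.

End Polytopes.

(* Main.v *)
Require Import Defs.
From mathcomp Require Import all_boot all_order all_algebra.
From mathcomp Require Import boolp classical_sets reals convex.
From mathcomp Require Import interval_inference.

(** Every Minkowski sum of coordinate simplices is a generalized
    permutohedron: its edges are parallel to vectors [e_i - e_k], and a vector
    with pairwise distinct coordinates is perpendicular to none of these.

    Concretely, let [F] be the face on which [dot c] attains its maximum over
    the sum, and let [x] and [y] be distinct points of [F], written as sums of
    points [f j] and [g j] of the simplices. Some summands [f j] and [g j]
    differ. Since a single summand can be exchanged freely for another point of
    its simplex ([minkowski_sum_exchange]), both [f j] and [g j] maximize
    [dot c] on that simplex. A maximizer over a simplex puts weight only on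
    maximizing vertices ([std_simplex_maximizer]), and two distinct maximizers
    put weight on two distinct vertices [e_i] and [e_k]
    ([std_simplex_neq_supp]). Exchanging [f j] for [e_i] and for [e_k] gives two
    points of [F] that differ by [e_i - e_k] ([face_root_direction]). It remains
    to see that an edge has two distinct points ([edge_two_points]). *)

Section OrientationVectors.
Local Set Implicit Arguments.
Local Unset Strict Implicit.
Import Order.TTheory GRing.Theory Num.Theory.
Local Open Scope classical_set_scope.
Local Open Scope ring_scope.
Variables (R : realType) (n : nat).
Implicit Types (c x y z f g mu : 'rV[R]_n) (I : {set 'I_n}) (P F : set 'rV[R]_n).

Lemma dotDr c x y : dot c (x + y) = dot c x + dot c y.
Proof. by rewrite -big_split; apply: eq_bigr => i _; rewrite mxE mulrDr. Qed.

Lemma dotBr c x y : dot c (x - y) = dot c x - dot c y.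
Proof. by rewrite -sumrB; apply: eq_bigr => i _; rewrite !mxE mulrBr. Qed.

Lemma dot_delta c (i : 'I_n) : dot c (delta_mx 0 i) = c 0 i.
Proof.
rewrite /dot (bigD1 i) //= mxE !eqxx mulr1 big1 ?addr0 // => k /negbTE ki.
by rewrite mxE ki andbF mulr0.
Qed.

Lemma std_simplex_vertex I (i : 'I_n) :
  i \in I -> std_simplex I (delta_mx 0 i : 'rV[R]_n).
Proof. by move=> iI; apply: sub_gen_smallest; exists i. Qed.

(** The right-hand side describes a convex set that contains the vertices,
    hence one that contains their hull. *)
Lemma std_simplex_barycentric I f : std_simplex I f ->
  [/\ forall i, 0 <= f 0 i, \sum_i f 0 i = 1 & forall i, i \notin I -> f 0 i = 0].
Proof.
pose B : set 'rV[R]_n := [set v | [/\ forall i, 0 <= v 0 i, \sum_i v 0 i = 1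
  & forall i, i \notin I -> v 0 i = 0]].
suff sub : std_simplex I `<=` B by move=> /sub.
apply: smallest_sub.
- move=> x y l; rewrite !inE => -[x0 x1 xI] [y0 y1 yI].
  have E i : (conv l x y : 'rV[R]_n) 0 i
             = l%:num * x 0 i + (1 - l%:num) * y 0 i by rewrite !mxE.
  split.
  + by move=> i; rewrite E addr_ge0 // mulr_ge0 // subr_ge0.
  + rewrite (eq_bigr _ (fun i _ => E i)) big_split /= -!mulr_sumr x1 y1 !mulr1.
    by rewrite addrC subrK.
  + by move=> i iI; rewrite E xI // yI // !mulr0 addr0.
- move=> _ [i /= iI <-]; split.
  + by move=> k; rewrite mxE ler0n.
  + rewrite (bigD1 i) //= mxE !eqxx big1 ?addr0 // => k /negbTE ki.
    by rewrite mxE ki andbF.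
  + move=> k kI; rewrite mxE; case: (eqVneq k i) => [ki|_]; last by rewrite andbF.
    by rewrite ki iI in kI.
Qed.

(** The value of [dot c] at [f] is the average of the [c 0 i] with weights
    [f 0 i]; an average that bounds its terms equals each term of positive
    weight. *)
Lemma std_simplex_maximizer I c f (i : 'I_n) : std_simplex I f ->
  (forall z, std_simplex I z -> dot c z <= dot c f) ->
  0 < f 0 i -> i \in I /\ c 0 i = dot c f.
Proof.
move=> /std_simplex_barycentric[f0 f1 fI] cmax fi0.
have supp k : 0 < f 0 k -> k \in I.
  by move=> fk; apply: contraLR fk => /fI ->; rewrite ltxx.
split; first exact: supp.
have ge0 k : true -> 0 <= (dot c f - c 0 k) * f 0 k.
  move=> _; have [fk|fk] := ltP 0 (f 0 k).
    rewrite mulr_ge0 // subr_ge0 -dot_delta; apply: cmax.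
    by apply: std_simplex_vertex; apply: supp.
  by rewrite (_ : f 0 k = 0) ?mulr0 //; apply/eqP; rewrite eq_le fk f0.
have sum0 : \sum_k (dot c f - c 0 k) * f 0 k = 0.
  under eq_bigr do rewrite mulrBl.
  by rewrite sumrB -mulr_sumr f1 mulr1 subrr.
have /eqP := psumr_eq0P ge0 sum0 (i := i) isT.
by rewrite mulf_eq0 (gt_eqF fi0) orbF subr_eq0 => /eqP.
Qed.

(** Vectors with equal coordinate sums are equal as soon as one dominates the
    other. *)
Lemma exists_gt_of_sum_eq f g : \sum_i f 0 i = \sum_i g 0 i -> f <> g ->
  exists i, g 0 i < f 0 i.
Proof.
move=> fg1 fg; apply/existsP; apply: contra_notT fg => /existsPn le_fg.
apply/rowP => i; apply/eqP; rewrite eq_sym -subr_eq0; apply/eqP.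
apply: (psumr_eq0P (P := predT) (F := fun k => g 0 k - f 0 k)) => // [k _|].
  by rewrite subr_ge0 leNgt le_fg.
by rewrite sumrB fg1 subrr.
Qed.

(** The vertices are found where [f] exceeds [g] and where [g] exceeds [f]. *)
Lemma std_simplex_neq_supp I f g : std_simplex I f -> std_simplex I g ->
  f <> g -> exists i k, [/\ i != k, 0 < f 0 i & 0 < g 0 k].
Proof.
move=> /std_simplex_barycentric[f0 f1 _] /std_simplex_barycentric[g0 g1 _] fg.
have [|//|i gfi] := @exists_gt_of_sum_eq f g; first by rewrite f1 g1.
have [||k fgk] := @exists_gt_of_sum_eq g f; [by rewrite f1 g1|exact: nesym|].
exists i, k; split; [|exact: le_lt_trans gfi|exact: le_lt_trans fgk].
by apply: contraTneq gfi => ->; rewrite -leNgt ltW.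
Qed.

Lemma minkowski_sum_exchange (J : finType) (D : {set J})
    (A : J -> set 'rV[R]_n) (f : J -> 'rV[R]_n) j z :
  (forall j, j \in D -> A j (f j)) -> j \in D -> A j z ->
  minkowski_sum D A (\sum_(j in D) f j + (z - f j)).
Proof.
move=> Af jD Az; exists (fun k => if k == j then z else f k).
  by move=> k kD; case: eqP => [->|_] //; apply: Af.
rewrite (bigD1 j) //= [RHS](bigD1 j) //= eqxx [LHS]addrC addrA subrK.
by congr (_ + _); apply: eq_bigr => k /andP[_ /negbTE ->].
Qed.

(** Exchanging a summand moves a point of the face, so it cannot increase
    [dot c]. *)
Lemma face_summand_max (J : finType) (D : {set J})
    (A : J -> set 'rV[R]_n) (f : J -> 'rV[R]_n) c (b : R) j z :
  (forall x, minkowski_sum D A x -> dot c x <= b) ->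
  (forall j, j \in D -> A j (f j)) -> dot c (\sum_(j in D) f j) = b ->
  j \in D -> A j z -> dot c z <= dot c (f j).
Proof.
move=> le_b Af fb jD Az; have := le_b _ (minkowski_sum_exchange Af jD Az).
by rewrite dotDr fb gerDl dotBr subr_le0.
Qed.

Lemma face_root_direction (J : finType) (D : {set J}) (E : J -> {set 'I_n}) F x y :
  is_face (minkowski_sum D (fun j => std_simplex (E j))) F ->
  F x -> F y -> x <> y ->
  exists u v i k, [/\ F u, F v, i != k & u - v = delta_mx 0 i - delta_mx 0 k].
Proof.
move=> [c [b [le_b ->]]] [[f Af ->] /= fb] [[g Ag ->] /= gb] fg.
have [j jD fgj] : exists2 j, j \in D & f j <> g j.
  apply: contrapT => nfg; apply: fg; apply: eq_bigr => j jD.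
  by apply: contrapT => fgj; apply: nfg; exists j.
have fmax z := face_summand_max (z := z) le_b Af fb jD.
have gmax z := face_summand_max (z := z) le_b Ag gb jD.
have fgM : dot c (g j) = dot c (f j).
  by apply/eqP; rewrite eq_le (fmax _ (Ag _ jD)) (gmax _ (Af _ jD)).
have [i [k [ik fi gk]]] := std_simplex_neq_supp (Af _ jD) (Ag _ jD) fgj.
have [iE ci] := std_simplex_maximizer (Af _ jD) fmax fi.
have [kE ck] := std_simplex_maximizer (Ag _ jD) gmax gk.
have exchF l : l \in E j -> c 0 l = dot c (f j) ->
    (minkowski_sum D (fun j => std_simplex (E j)) `&` [set x | dot c x = b])
      (\sum_(j in D) f j + (delta_mx 0 l - f j)).
  move=> lE cl; split; first by apply: minkowski_sum_exchange => //; apply: std_simplex_vertex.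
  by rewrite /= dotDr dotBr fb dot_delta cl subrr addr0.
exists (\sum_(j in D) f j + (delta_mx 0 i - f j)),
  (\sum_(j in D) f j + (delta_mx 0 k - f j)), i, k.
split=> //; [exact: exchF|by apply: exchF => //; rewrite ck|].
by rewrite opprD addrACA subrr add0r opprB addrA subrK.
Qed.

(** A set without two distinct points is its own affine hull, which then
    contains no line. *)
Lemma edge_two_points P F : is_edge P F -> exists x y, [/\ F x, F y & x <> y].
Proof.
move=> [_ [p [U [hullF dimU]]]]; apply: contrapT => noF.
have subF x y : F x -> F y -> x = y.
  by move=> Fx Fy; apply: contrapT => xy; apply: noF; exists x, y.
have affF : affine_set F.
  by move=> t x y Fx Fy; rewrite (subF y x) // -scalerDl addrC subrK scale1r.
have hF : F = [set p + u | u in [set` U]].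
  by rewrite -hullF /affine_hull smallest_id.
have F0 : F (p + 0) by rewrite hF; exists 0 => //=; exact: mem0v.
have Fu : F (p + vpick U) by rewrite hF; exists (vpick U) => //=; exact: memv_pick.
have /addrI/eqP := subF _ _ Fu F0.
by rewrite vpick0 -dimv_eq0 dimU.
Qed.

Lemma minkowski_sum_simplices_orientation (J : finType) (D : {set J})
    (E : J -> {set 'I_n}) mu : injective (mu 0) ->
  orientation_vector (minkowski_sum D (fun j => std_simplex (E j))) mu.
Proof.
move=> mu_inj F edgeF perpF; have [x [y [Fx Fy xy]]] := edge_two_points edgeF.
have [u [v [i [k [Fu Fv ik uv]]]]] := face_root_direction edgeF.1 Fx Fy xy.
have /eqP := perpF _ _ Fu Fv.
by rewrite uv dotBr !dot_delta subr_eq0 => /eqP/mu_inj/eqP; apply/negP.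
Qed.

End OrientationVectors.

Theorem corollary3p22 (R : realType) (n : nat) (HH : {set {set 'I_n}})
  (hypHH : is_hypergraph [set: 'I_n]%SET HH)
  (connHH : hyper_connected [set: 'I_n]%SET HH)
  (mu : 'rV[R]_n)
  (mu_decr : forall i j : 'I_n, (i < j)%N -> (mu 0 j < mu 0 i)%R) :
  orientation_vector (postnikov_polytope HH) mu.
Proof.
apply: (@minkowski_sum_simplices_orientation _ _ _ _ id) => i j mu_ij.
by have [/mu_decr|/mu_decr|/val_inj//] := ltngtP i j;
  rewrite mu_ij Order.POrderTheory.ltxx.
Qed.
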